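(* Consider a matching market consisting of a finite simple bipartite graph $G=(V,E)$ with $V = D \sqcup H$ (doctors and hospitals), a matroid $\mathbf{M}_h=(E(h),\mathcal{I}_h)$ for each $h\in H$ in which every singleton $\{e\}$, $e\in E(h)$, is independent, preferences $\succsim_d$ for each $d\in D$, and responsive preferences $\succsim_h$ for each $h\in H$, all as specified in the context. Let $\mathcal{SS}$ be the set of strongly stable matchings in $G$ (matchings $\mu$ such that no edge in $E\setminus\mu$ weakly blocks $\mu$), and let $\mathcal{C}_S$ be the strong core (the set of matchings $\mu$ in $G$ such that no non-empty subset of $V$ weakly blocks $\mu$). Then $\mathcal{SS}=\mathcal{C}_S$.
   Context: Notation: for a set $X$ and an element $x$, $X+x := X\cup\{x\}$ and $X-x := X\setminus\{x\}$. Graph: $G=(V,E)$ is a finite simple undirected bipartite graph; $V$ is partitioned into $D$ (doctors) and $H$ (hospitals), and every edge joins a vertex of $D$ and a vertex of $H$. The edge joining $d\in D$ and $h\in H$, if it exists, is written $(d,h)$. For $F\subseteq E$ and $v\in V$, $F(v)$ is the set of edges of $F$ incident to $v$. Matroids: for each $h\in H$, $\mathbf{M}_h=(E(h),\mathcal{I}_h)$ is a matroid (with family of independent sets $\mathcal{I}_h$) such that $\{e\}\in\mathcal{I}_h$ for every $e\in E(h)$. If $I\in\mathcal{I}_h$, $e\in E(h)\setminus I$ and $I+e\notin\mathcal{I}_h$, then $\mathsf{C}_{\mathbf{M}_h}(e,I)$ denotes the fundamental circuit, i.e. the unique circuit of $\mathbf{M}_h$ contained in $I+e$ (it contains $e$),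 and $\mathsf{D}_{\mathbf{M}_h}(e,I):=\mathsf{C}_{\mathbf{M}_h}(e,I)-e$. Preferences: for each $d\in D$, $\succsim_d$ is a transitive and complete binary relation on $E(d)\cup\{\emptyset\}$ (complete: for all elements $e,f$, including $e=f$, at least one of $e\succsim_d f$, $f\succsim_d e$ holds) such that for every $e\in E(d)$, $e\succsim_d\emptyset$ and $\emptyset\not\succsim_d e$. For each $h\in H$, $\succsim_h$ is a transitive and complete binary relation on $\mathcal{I}_h$ such that for every non-empty $I\in\mathcal{I}_h$, $I\succsim_h\emptyset$ and $\emptyset\not\succsim_h I$. For $v\in V$, $a\succ_v b$ means $a\succsim_v b$ and $b\not\succsim_v a$; $a\sim_v b$ means $a\succsim_v b$ and $b\succsim_v a$. For $e,f\in E(h)$, write $e\succsim_h f$, $e\succ_h f$, $e\sim_h f$ for $\{e\}\succsim_h\{f\}$, $\{e\}\succ_h\{f\}$, $\{e\}\sim_h\{f\}$. Responsiveness: for every $h\in H$: (1) for every $I\in\mathcal{I}_h$ and $e\in I$, $I\succ_h I-e$; (2) for every $I\in\mathcal{I}_h$, $e\in E(h)\setminus I$ and $f\in I$ with $I+e-f\in\mathcal{I}_h$, we have $I+e-f\succsim_h I$ if and only if $e\succsim_h f$. Matchings: a matching in $G$ is a subset $\mu\subseteq E$ with $|\mu(d)|\le 1$ for every $d\in D$ and $\mu(h)\in\mathcal{I}_h$ for every $h\in H$. For a doctor $d$, $\mu(d)$ is identified with its unique element if non-empty (and is $\emptyset$ otherwise). Blocking edges: let $\mu$ be a matching and $e=(d,h)\in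 E\setminus\mu$. The edge $e$ weakly blocks (resp. strongly blocks) $\mu$ on $d$ if $e\succsim_d\mu(d)$ (resp. $e\succ_d\mu(d)$). It weakly blocks (resp. strongly blocks) $\mu$ on $h$ if either $\mu(h)+e\in\mathcal{I}_h$, or $\mu(h)+e\notin\mathcal{I}_h$ and there is $f\in\mathsf{D}_{\mathbf{M}_h}(e,\mu(h))$ with $e\succsim_h f$ (resp. $e\succ_h f$). The edge $e$ weakly blocks $\mu$ if it weakly blocks $\mu$ on both $d$ and $h$, and strongly blocks $\mu$ on at least one of $d$ and $h$. Blocking coalitions: for non-empty $C\subseteq V$, $E(C)$ is the set of edges $(d,h)\in E$ with $d,h\in C$, and $\mathcal{M}(C)$ is the set of matchings $\sigma$ in $G$ with $\sigma(v)\subseteq E(C)$ for every $v\in C$. A non-empty set $C\subseteq V$ weakly blocks a matching $\mu$ if there is $\sigma\in\mathcal{M}(C)$ such that $\sigma(v)\succsim_v\mu(v)$ for every $v\in C$, and $\sigma(v)\succ_v\mu(v)$ for some $v\in C$. *)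

(* Defs.v *)
From HB Require Import structures.
From mathcomp Require Import all_boot.

Set Implicit Arguments.
Unset Strict Implicit.
Unset Printing Implicit Defensive.

(** * Matroids on a finite ground set *)

Record matroid (T : finType) (S : {set T}) := Matroid {
  indep : {set {set T}};
  indep_ground : forall I, I \in indep -> I \subset S;
  indep0 : set0 \in indep;
  indep_hereditary : forall I J : {set T},
    J \in indep -> I \subset J -> I \in indep;
  indep_augment : forall I J : {set T},
    I \in indep -> J \in indep -> #|I| < #|J| ->
    exists2 e, e \in J :\: I & e |: I \in indep
}.

Section Circuits.

Variables (T : finType) (S : {set T}) (M : matroid S).

Definition circuit (C : {set T}) : bool :=
  minset [pred X : {set T} | (X \subset S) && (X \notin indep M)] C.

Lemma circuit_exists (e : T) (I : {set T}) :
  I \in indep M -> e \in S -> e |: I \notin indep M ->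
  exists2 C, circuit C & C \subset e |: I.
Proof.
move=> iI eS dI.
have [] := @minset_exists T [pred X : {set T} | (X \subset S) && (X \notin indep M)]
  (e |: I).
  by rewrite /= dI subUset sub1set eS (indep_ground iI).
by move=> C mC sC; exists C.
Qed.

Lemma circuit_unique (e : T) (I C1 C2 : {set T}) :
  I \in indep M -> circuit C1 -> circuit C2 ->
  C1 \subset e |: I -> C2 \subset e |: I -> C1 = C2.
Proof.
move=> iI /minsetP[/andP[S1 d1] m1] /minsetP[/andP[S2 d2] m2] s1 s2.
have eC C : C \notin indep M -> C \subset e |: I -> e \in C.
  move=> dC sC; apply: contraR dC => neC.
  apply: (indep_hereditary iI); apply/subsetP=> x xC.
  have := subsetP sC x xC; rewrite in_setU1 => /orP[/eqP xe|//].
  by rewrite -xe xC in neC.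
have e1 := eC _ d1 s1; have e2 := eC _ d2 s2.
have [s12|] := boolP (C1 \subset C2); first by apply: m2 => //; rewrite /= S1.
case/subsetPn=> f f1 f2.
have fe : f != e by apply: contraNneq f2 => ->.
have i1 : C1 :\ f \in indep M.
  apply: contraT => d; have := m1 (C1 :\ f).
  rewrite /= d (subset_trans (subD1set _ _) S1) subD1set => /(_ isT isT) E.
  by have := setD11 f C1; rewrite E f1.
pose Q := [pred X : {set T} | (X \subset e |: I) && (X \in indep M)].
have [|J /maxsetP[/andP[sJ iJ] mJ] s1J] := @maxset_exists T Q (C1 :\ f).
  by rewrite /= i1 (subset_trans (subD1set _ _) s1).
have IJ : #|I| <= #|J|.
  rewrite leqNgt; apply/negP => lt.
  have [x /setDP[xI xJ] ix] := indep_augment iJ iI lt.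
  have E : x |: J = J.
    apply: mJ; last exact: subsetUr.
    by rewrite /= ix subUset sJ andbT sub1set in_setU1 xI orbT.
  by rewrite -E setU11 in xJ.
have fJ : f \notin J.
  apply: contra d1 => fJ; apply: (indep_hereditary iJ).
  by rewrite -(setD1K f1) subUset sub1set fJ.
have fI : f \in e |: I := subsetP s1 _ f1.
have EJ : J = (e |: I) :\ f.
  apply/eqP; rewrite eqEcard subsetD1 sJ fJ /=.
  apply: leq_trans IJ; rewrite -ltnS -add1n -[1]/(true : nat) -{1}fI -cardsD1.
  by rewrite cardsU1 -add1n leq_add2r leq_b1.
by case/negP: d2; apply: (indep_hereditary iJ); rewrite EJ subsetD1 s2.
Qed.

(* Only meaningful when [I] is independent, [e \in S :\: I] and [e |: I] is
   dependent: [circuit_exists] and [circuit_unique] show that in this case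
   exactly one circuit satisfies the condition.  Otherwise it is [set0] or an
   unspecified circuit. *)
Definition fund_circuit (e : T) (I : {set T}) : {set T} :=
  odflt set0 [pick C : {set T} | circuit C & C \subset e |: I].

Definition fund_rest (e : T) (I : {set T}) : {set T} :=
  fund_circuit e I :\ e.

End Circuits.

(** * Preferences *)

Definition strict (T : Type) (R : rel T) : rel T :=
  fun x y => R x y && ~~ R y x.

(** * Bipartite graphs *)

Section Graph.

Variables D H : finType.

(* The vertex set is the disjoint union [D + H]; a simple bipartite graph is its
   set of edges, the edge joining [d] and [h] being the pair [(d, h)]. *)
Definition incident (v : D + H) (e : D * H) : bool :=
  match v with inl d => e.1 == d | inr h => e.2 == h end.

Definition edges_at (F : {set D * H}) (v : D + H) : {set D * H} :=
  [set e in F | incident v e].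

(* [E(d)] together with the outside option, written [None]. *)
Definition doctor_options (E : {set D * H}) (d : D) : {set option (D * H)} :=
  None |: [set Some e | e in edges_at E (inl d)].

End Graph.

(** * Matching markets *)

(* Preference relations are given on ambient types; they are constrained, and
   used, only on [E(d) + None] for a doctor and on the independent sets of the
   matroid for a hospital. [total] includes reflexivity. *)
Record market (D H : finType) := Market {
  edges : {set D * H};
  mat : forall h : H, matroid (edges_at edges (inr h));
  mat_singleton : forall h e,
    e \in edges_at edges (inr h) -> [set e] \in indep (mat h);
  dpref : D -> rel (option (D * H));
  dpref_trans : forall d,
    {in doctor_options edges d & &, transitive (dpref d)};
  dpref_total : forall d, {in doctor_options edges d &, total (dpref d)};
  dpref_None : forall d e,
    e \in edges_at edges (inl d) -> strict (dpref d) (Some e) None;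
  hpref : H -> rel {set D * H};
  hpref_trans : forall h, {in indep (mat h) & &, transitive (hpref h)};
  hpref_total : forall h, {in indep (mat h) &, total (hpref h)};
  hpref_set0 : forall h I,
    I \in indep (mat h) -> I != set0 -> strict (hpref h) I set0
}.

Section Market.

Variables (D H : finType) (G : market D H).

Definition responsive : Prop := forall h : H,
  (forall I e, I \in indep (mat G h) -> e \in I ->
     strict (hpref G h) I (I :\ e)) /\
  (forall I e f, I \in indep (mat G h) ->
     e \in edges_at (edges G) (inr h) :\: I -> f \in I ->
     (e |: I) :\ f \in indep (mat G h) ->
     (hpref G h ((e |: I) :\ f) I <-> hpref G h [set e] [set f])).

Definition matching (mu : {set D * H}) : bool :=
  [&& mu \subset edges G,
      [forall d : D, #|edges_at mu (inl d)| <= 1] &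
      [forall h : H, edges_at mu (inr h) \in indep (mat G h)]].

(* For a matching, [edges_at mu (inl d)] has at most one element, so nothing is
   lost by [pick]. *)
Definition assigned (mu : {set D * H}) (d : D) : option (D * H) :=
  [pick e in edges_at mu (inl d)].

(** ** Blocking edges *)

(* In the following definitions [R] is instantiated with the identity for weak
   blocking and with [strict] for strong blocking. *)
Definition blocks_doctor (R : rel (option (D * H)) -> rel (option (D * H)))
    (mu : {set D * H}) (e : D * H) : bool :=
  R (dpref G e.1) (Some e) (assigned mu e.1).

Definition blocks_hospital (R : rel {set D * H} -> rel {set D * H})
    (mu : {set D * H}) (e : D * H) : bool :=
  let I := edges_at mu (inr e.2) in
  (e |: I \in indep (mat G e.2)) ||
  (e |: I \notin indep (mat G e.2)) &&
    [exists f in fund_rest (mat G e.2) e I,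
       R (hpref G e.2) [set e] [set f]].

Definition weakly_blocks_doctor := blocks_doctor id.
Definition strongly_blocks_doctor := blocks_doctor (@strict _).
Definition weakly_blocks_hospital := blocks_hospital id.
Definition strongly_blocks_hospital := blocks_hospital (@strict _).

Definition edge_weakly_blocks (mu : {set D * H}) (e : D * H) : bool :=
  [&& weakly_blocks_doctor mu e, weakly_blocks_hospital mu e &
      strongly_blocks_doctor mu e || strongly_blocks_hospital mu e].

Definition strongly_stable_matchings : {set {set D * H}} :=
  [set mu | matching mu &
     [forall e in edges G :\: mu, ~~ edge_weakly_blocks mu e]].

(** ** Blocking coalitions *)

Definition edges_within (C : {set D + H}) : {set D * H} :=
  [set e in edges G | (inl e.1 \in C) && (inr e.2 \in C)].

Definition matchings_within (C : {set D + H}) : {set {set D * H}} :=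
  [set sigma | matching sigma &
     [forall v in C, edges_at sigma v \subset edges_within C]].

(* [vpref v sigma mu] compares [sigma(v)] with [mu(v)]. *)
Definition vpref (v : D + H) : rel {set D * H} := fun sigma mu =>
  match v with
  | inl d => dpref G d (assigned sigma d) (assigned mu d)
  | inr h => hpref G h (edges_at sigma (inr h)) (edges_at mu (inr h))
  end.

Definition coalition_weakly_blocks (C : {set D + H}) (mu : {set D * H}) : bool :=
  [exists sigma in matchings_within C,
     [forall v in C, vpref v sigma mu] &&
     [exists v in C, strict (vpref v) sigma mu]].

Definition strong_core : {set {set D * H}} :=
  [set mu | matching mu &
     [forall C : {set D + H},
        (C != set0) ==> ~~ coalition_weakly_blocks C mu]].

End Market.

(* Main.v *)
Require Import Defs.
From mathcomp Require Import all_boot.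

(** If a single edge [e] at [h] blocks [mu], then [h], the doctor of [e] and the
    doctors that [h] keeps form a blocking coalition.  Conversely, let [mu] be
    strongly stable and let [sigma] be a deviation of a coalition containing
    [h].  Each [e] in [sigma(h) \ mu(h)] is dependent on [mu(h)] and weakly
    worse than every element of [D(e, mu(h))].  Exchanging these [e] one at a
    time for suitable elements of [D(e, mu(h))] turns [sigma(h)] into a subset
    of [mu(h)] through weakly improving steps, so [h] weakly prefers [mu(h)],
    strictly so if some doctor strictly gains at [h]. *)

Lemma setU1D1 (T : finType) (e f : T) (A : {set T}) :
  e != f -> (e |: A) :\ f = e |: (A :\ f).
Proof.
by move=> ef; rewrite setDUl; congr (_ :|: _); apply/setDidPl;
  rewrite disjoints1 in_set1.
Qed.

(** * Exchanges along fundamental circuits *)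

Section Matroids.

Set Implicit Arguments.
Unset Strict Implicit.

Variables (T : finType) (S : {set T}) (M : matroid S).
Implicit Types (e f : T) (A B I J : {set T}).

(** A maximal independent set between [A] and [A :|: B] works: were it smaller than [B],
    augmentation would enlarge it inside [A :|: B]. *)
Lemma indep_extend A B : A \in indep M -> B \in indep M ->
  exists K, [/\ K \in indep M, A \subset K, K \subset A :|: B & #|B| <= #|K|].
Proof.
move=> iA iB.
pose P := [pred X : {set T} | (X \subset A :|: B) && (X \in indep M)].
have [|K /maxsetP[/andP[sK iK] mK] sAK] := @maxset_exists T P A.
  by rewrite /= iA subsetUl.
exists K; split=> //; rewrite leqNgt; apply/negP => lt.
have [x /setDP[xB xK] ix] := indep_augment iK iB lt.
have E : x |: K = K.
  apply: mK; last exact: subsetUr.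
  by rewrite /= ix subUset sK andbT sub1set in_setU xB orbT.
by rewrite -E setU11 in xK.
Qed.

Lemma fund_circuitP e I : I \in indep M -> e \in S -> e |: I \notin indep M ->
  circuit M (fund_circuit M e I) /\ fund_circuit M e I \subset e |: I.
Proof.
move=> iI eS dI; rewrite /fund_circuit; case: pickP => [C /andP[]//|no].
by have [C cC sC] := circuit_exists iI eS dI; have := no C; rewrite cC sC.
Qed.

Lemma fund_rest_sub e I : I \in indep M -> e \in S ->
  e |: I \notin indep M -> fund_rest M e I \subset I.
Proof. by move=> iI eS dI; rewrite subDset; case: (fund_circuitP iI eS dI). Qed.

(** A circuit inside [(e |: I) :\ f] would be the fundamental circuit by uniqueness, yet it misses
    [f]. *)
Lemma fund_rest_remove e f I : I \in indep M -> e \in S -> e \notin I ->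
  e |: I \notin indep M -> f \in fund_rest M e I -> (e |: I) :\ f \in indep M.
Proof.
move=> iI eS eI dI fC; have fI := subsetP (fund_rest_sub iI eS dI) _ fC.
have ef : e != f by apply: contraNneq eI => ->.
rewrite setU1D1 //; apply: contraT => d.
have [C' cC' sC'] := circuit_exists (indep_hereditary iI (subD1set I f)) eS d.
have [cC sC] := fund_circuitP iI eS dI.
have E : fund_circuit M e I = C'.
  apply: (circuit_unique iI cC cC' sC).
  by apply: subset_trans sC' _; rewrite setUS // subD1set.
move: fC; rewrite /fund_rest E in_setD1 => /andP[_ /(subsetP sC')].
by rewrite in_setU1 setD11 eq_sym (negPf ef).
Qed.

(* Otherwise the circuit minus [e], hence [e] itself, would lie in the closure of
   [J :\ e], contradicting the independence of [J]. *)
Lemma fund_rest_exchange e I J : I \in indep M -> J \in indep M ->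
  e \in J -> e |: I \notin indep M ->
  exists f, [/\ f \in fund_rest M e I, f \notin J & (f |: J) :\ e \in indep M].
Proof.
move=> iI iJ eJ dI; have eS := subsetP (indep_ground iJ) e eJ.
have [/minsetP[/andP[_ dC] _] _] := fund_circuitP iI eS dI.
have iC := indep_hereditary iI (fund_rest_sub iI eS dI).
(* [K] contains the circuit minus [e], hence not [e], and is larger than [J :\ e]. Augmenting
   [J :\ e] from [K] thus yields an element outside [J], which must come from the circuit. *)
have [K [iK CK sK JK]] := indep_extend iC iJ.
have eK : e \notin K.
  apply: contra dC => eK; rewrite /fund_rest in CK; apply: (indep_hereditary iK).
  by move: CK; rewrite subDset (setUidPr _) // sub1set.
have iJe := indep_hereditary iJ (subD1set J e).
have lt : #|J :\ e| < #|K| by move: JK; rewrite (cardsD1 e J) eJ.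
have [f /setDP[fK fJe] if_] := indep_augment iJe iK lt.
have fe : f != e by apply: contraNneq eK => <-.
have fJ : f \notin J by move: fJe; rewrite in_setD1 fe.
exists f; split=> //.
  by move: (subsetP sK f fK); rewrite in_setU (negPf fJ) orbF.
by rewrite setU1D1.
Qed.

End Matroids.

Section Markets.

Set Implicit Arguments.
Unset Strict Implicit.

Variables (D H : finType) (G : market D H).
Implicit Types (d : D) (h : H) (e f : D * H) (I J mu sigma : {set D * H}).

Local Notation E := (edges G).

Lemma strict_hpref h I J : I \in indep (mat G h) -> J \in indep (mat G h) ->
  ~~ hpref G h I J -> strict (hpref G h) J I.
Proof.
move=> iI iJ n; rewrite /strict n andbT.
by move: (hpref_total iI iJ); rewrite (negPf n).
Qed.

Lemma matching_indep mu h :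
  matching G mu -> edges_at mu (inr h) \in indep (mat G h).
Proof. by case/and3P=> _ _ /forallP. Qed.

Lemma matching_sub mu : matching G mu -> mu \subset E.
Proof. by case/and3P. Qed.

(** * Hospital preferences under exchanges *)

Section Responsive.

Hypothesis hG : responsive G.

(** The second equality is responsiveness for the reverse exchange, which leads from [(e |: I) :\ f]
    back to [I]. *)
Lemma hpref_exchange h I e f : I \in indep (mat G h) ->
  e \in edges_at E (inr h) -> e \notin I -> f \in I ->
  (e |: I) :\ f \in indep (mat G h) ->
  hpref G h ((e |: I) :\ f) I = hpref G h [set e] [set f] /\
  hpref G h I ((e |: I) :\ f) = hpref G h [set f] [set e].
Proof.
move=> iI eE eI fI iK; have [_ R] := hG h.
have ef : e != f by apply: contraNneq eI => ->.
have fE := subsetP (indep_ground iI) f fI.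
have EI : (f |: (e |: I) :\ f) :\ e = I.
  by rewrite setD1K ?in_setU1 ?fI ?orbT // setU1K.
have eD : e \in edges_at E (inr h) :\: I by rewrite in_setD eI.
have fD : f \in edges_at E (inr h) :\: ((e |: I) :\ f) by rewrite in_setD setD11.
have eK : e \in (e |: I) :\ f by rewrite in_setD1 ef setU11.
have := R _ f e iK fD eK; rewrite EI => /(_ iI) R2.
have R1 := R I e f iI eD fI iK.
by split; apply/idP/idP; first [move/R1 | move/R2].
Qed.

Lemma hpref_subset h I J :
  J \in indep (mat G h) -> I \subset J -> hpref G h J I.
Proof.
move=> iJ; elim: {I}_.+1 {-2}I (ltnSn #|J :\: I|) => // n IH I lt sIJ.
have [JI|] := boolP (J \subset I).
  have -> : I = J by apply/eqP; rewrite eqEsubset sIJ.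
  by have := hpref_total iJ iJ; rewrite orbb.
case/subsetPn=> e eJ eI.
have sK : e |: I \subset J by rewrite subUset sub1set eJ.
have iK := indep_hereditary iJ sK; have iI := indep_hereditary iJ sIJ.
apply: (hpref_trans iK iJ iI).
  apply: IH => //; move: lt.
  by rewrite (cardsD1 e) in_setD eI eJ setDDl (setUC I).
by have [R _] := hG h; case/andP: (R _ e iK (setU11 e I)); rewrite setU1K.
Qed.

(** With [I] and [J] the edges of [mu] and [sigma] at [h], this says that no new edge strongly
    blocks [mu] on [h]. *)
Definition dominated h I J : Prop := forall e, e \in J :\: I ->
  e |: I \notin indep (mat G h) /\
  forall f, f \in fund_rest (mat G h) e I -> hpref G h [set f] [set e].

(** [K] is [J] with [e] exchanged for [f]. Since [f] lies in [I], only [e] disappears from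
    [J :\: I]. The last equality keeps track of strictness. *)
Lemma dominated_step h I J e :
  I \in indep (mat G h) -> J \in indep (mat G h) ->
  dominated h I J -> e \in J :\: I ->
  exists f K, [/\ f \in fund_rest (mat G h) e I, K \in indep (mat G h),
    K :\: I = (J :\: I) :\ e, hpref G h K J &
    hpref G h J K = hpref G h [set e] [set f]].
Proof.
move=> iI iJ dom eJI; have [dI ge] := dom e eJI; move: eJI => /setDP[eJ eI].
have eS := subsetP (indep_ground iJ) e eJ.
have [f [fC fJ iK]] := fund_rest_exchange iI iJ eJ dI.
have fI := subsetP (fund_rest_sub iI eS dI) f fC.
have fS := subsetP (indep_ground iI) f fI.
have [K1 K2] := hpref_exchange iJ fS fJ eJ iK.
exists f, ((f |: J) :\ e); split; rewrite ?K1 ?ge //.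
apply/setP=> x; rewrite !inE; have [->|_] := eqVneq x f; last by rewrite andbCA.
by rewrite fI /= andbF.
Qed.

(** Induction on the size of [J :\: I]. All circuits refer to the fixed set [I], so domination
    survives each exchange. *)
Lemma hpref_dominated h I J :
  I \in indep (mat G h) -> J \in indep (mat G h) -> dominated h I J ->
  hpref G h I J.
Proof.
move=> iI; elim: {J}_.+1 {-2}J (ltnSn #|J :\: I|) => // n IH J lt iJ dom.
have [JI|] := boolP (J \subset I); first exact: hpref_subset.
case/subsetPn=> e eJ eI; have eJI : e \in J :\: I by rewrite in_setD eI.
have [f [K [fC iK EK KJ _]]] := dominated_step iI iJ dom eJI.
apply: (hpref_trans iK iI iJ) => //; apply: IH => //.
  by rewrite EK; move: lt; rewrite (cardsD1 e) eJI.
by move=> x; rewrite EK => /setD1P[_]; apply: dom.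
Qed.

(** Exchange [e] first. As [I] is weakly preferred to the resulting [K], a weak preference for [J]
    over [I] would pass to [J] over [K], that is, to [e] over [f]. *)
Lemma strict_hpref_dominated h I J e :
  I \in indep (mat G h) -> J \in indep (mat G h) -> dominated h I J ->
  e \in J :\: I ->
  (forall f, f \in fund_rest (mat G h) e I -> ~~ hpref G h [set e] [set f]) ->
  ~~ hpref G h J I.
Proof.
move=> iI iJ dom eJI st.
have [f [K [fC iK EK _ JK]]] := dominated_step iI iJ dom eJI.
apply: contra (st f fC) => JI; rewrite -JK; apply: (hpref_trans iI iJ iK) => //.
apply: hpref_dominated => // x.
by rewrite EK => /setD1P[_]; apply: dom.
Qed.

Lemma blocks_hospital_improves mu e :
  matching G mu -> e \in E :\: mu -> weakly_blocks_hospital G mu e ->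
  let I := edges_at mu (inr e.2) in
  exists J, [/\ J \in indep (mat G e.2), e \in J, J \subset e |: I,
    hpref G e.2 J I & strongly_blocks_hospital G mu e -> ~~ hpref G e.2 I J].
Proof.
move=> mmu /setDP[eE emu] wh I.
have iI : I \in indep (mat G e.2) by apply: matching_indep.
have eS : e \in edges_at E (inr e.2) by rewrite inE eE /=.
have eI : e \notin I by rewrite inE (negPf emu).
have [iJ|dI] := boolP (e |: I \in indep (mat G e.2)).
  have [R _] := hG e.2; have := R _ e iJ (setU11 e I).
  rewrite setU1K // => /andP[JI nIJ].
  by exists (e |: I); split=> //; apply: setU11.
have exch f : f \in fund_rest (mat G e.2) e I -> hpref G e.2 [set e] [set f] ->
  (strongly_blocks_hospital G mu e -> ~~ hpref G e.2 [set f] [set e]) ->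
  exists J, [/\ J \in indep (mat G e.2), e \in J, J \subset e |: I,
    hpref G e.2 J I & strongly_blocks_hospital G mu e -> ~~ hpref G e.2 I J].
  move=> fC ef st; have fI := subsetP (fund_rest_sub iI eS dI) f fC.
  have iJ := fund_rest_remove iI eS eI dI fC.
  have [K1 K2] := hpref_exchange iI eS eI fI iJ.
  exists ((e |: I) :\ f); split; rewrite ?K1 ?K2 ?subD1set //.
  by rewrite in_setD1 setU11 andbT; apply: contraNneq eI => ->.
(* A strict witness is chosen whenever one exists, so that a single [J] meets both the weak and the
   strict claim. *)
case/orP: (orbN (strongly_blocks_hospital G mu e)) => [sh|nsh].
  case/orP: (sh) => [|/andP[_ /existsP[f /and3P[fC ef nfe]]]].
    by rewrite (negPf dI).
  exact: exch fC ef (fun _ => nfe).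
case/orP: wh => [|/andP[_ /existsP[f /andP[fC ef]]]]; first by rewrite (negPf dI).
by apply: exch fC ef _ => sh; rewrite sh in nsh.
Qed.

End Responsive.

(** * Assignments of doctors, and edges that do not block *)

Lemma assigned_mem mu e : matching G mu -> e \in mu -> assigned mu e.1 = Some e.
Proof.
case/and3P=> _ /forallP/(_ e.1) /card_le1_eqP le1 _ emu.
have ee : e \in edges_at mu (inl e.1) by rewrite inE emu /=.
rewrite /assigned; case: pickP => [x /le1 E|/(_ e)]; last by rewrite ee.
by rewrite (E e ee).
Qed.

Lemma assigned_Some mu d e : assigned mu d = Some e -> e \in mu /\ e.1 = d.
Proof.
by rewrite /assigned; case: pickP => // x; rewrite inE /= => /andP[xm /eqP xd] [<-].
Qed.

Lemma assigned_option mu d :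
  matching G mu -> assigned mu d \in doctor_options E d.
Proof.
move=> /matching_sub/subsetP sE; rewrite in_setU1.
case A : (assigned mu d) => [e|] //=.
have [/sE eE ed] := assigned_Some A.
by rewrite imset_f // inE eE /= ed.
Qed.

Lemma edge_option e : e \in E -> Some e \in doctor_options E e.1.
Proof. by move=> eE; rewrite in_setU1 /= imset_f // inE eE /=. Qed.

(** Strong blocking on the hospital would make [e] a blocking edge; completeness turns its failure
    into weak preference for each [f]. If the doctor gains strictly, even weak blocking on the
    hospital is excluded. *)
Lemma stable_dominated mu e : matching G mu -> e \in E -> e \notin mu ->
  ~~ edge_weakly_blocks G mu e -> weakly_blocks_doctor G mu e ->
  let I := edges_at mu (inr e.2) in
  [/\ e |: I \notin indep (mat G e.2),
      forall f, f \in fund_rest (mat G e.2) e I ->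
        hpref G e.2 [set f] [set e] &
      strongly_blocks_doctor G mu e ->
        forall f, f \in fund_rest (mat G e.2) e I ->
        ~~ hpref G e.2 [set e] [set f]].
Proof.
move=> mmu eE emu nb wd I.
have iI : I \in indep (mat G e.2) := matching_indep _ mmu.
have eS : e \in edges_at E (inr e.2) by rewrite inE eE /=.
have ns : ~~ strongly_blocks_hospital G mu e.
  apply: contra nb => sh; rewrite /edge_weakly_blocks wd sh orbT andbT /=.
  case/orP: sh => [i|/andP[d /existsP[f /andP[fC /andP[ef _]]]]].
    by rewrite /weakly_blocks_hospital /blocks_hospital i.
  apply/orP; right; rewrite d /=; apply/existsP; exists f.
  by rewrite fC.
have [dI nf] : e |: I \notin indep (mat G e.2) /\
  forall f, f \in fund_rest (mat G e.2) e I -> ~~ strict (hpref G e.2) [set e] [set f].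
  move: ns; rewrite /strongly_blocks_hospital /blocks_hospital -/I negb_or.
  case/andP=> dI; rewrite dI => /existsPn n; split=> // f fC.
  by have := n f; rewrite fC.
have sub := fund_rest_sub iI eS dI.
split=> // [f fC|sd f fC].
  apply: contraR (nf f fC); apply: strict_hpref; apply: mat_singleton => //.
  exact: subsetP (indep_ground iI) f (subsetP sub f fC).
apply: contra nb => ef; rewrite /edge_weakly_blocks wd sd /= andbT.
apply/orP; right; rewrite dI /=; apply/existsP; exists f.
by rewrite fC.
Qed.

(** * Blocking edges versus blocking coalitions *)

Lemma edges_at_star h J :
  J \subset edges_at E (inr h) -> edges_at J (inr h) = J.
Proof.
move=> /subsetP sJ; apply/setP=> x; rewrite inE andb_idr // => /sJ.
by rewrite inE => /andP[].
Qed.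

(** Edges at one hospital are determined by their doctors, and every other hospital receives the
    empty set. *)
Lemma star_matching h J : J \in indep (mat G h) -> matching G J.
Proof.
move=> iJ; have /subsetP sJ := indep_ground iJ.
have JP x : x \in J -> x \in E /\ x.2 = h.
  by move/sJ; rewrite inE /= => /andP[xE /eqP].
apply/and3P; split; first by apply/subsetP=> x /JP[].
  apply/forallP=> d; apply/card_le1_eqP=> x y; rewrite !inE /=.
  case/andP=> /JP[_ x2] /eqP x1 /andP[/JP[_ y2] /eqP y1].
  by apply/eqP; rewrite -pair_eqE /pair_eq x1 x2 y1 y2 !eqxx.
apply/forallP=> k; have [->|kh] := eqVneq k h.
  by rewrite edges_at_star // (indep_ground iJ).
suff -> : edges_at J (inr k) = set0 by apply: indep0.
apply/setP=> x; rewrite !inE /=; apply/negP=> /andP[/JP[_ ->]].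
by rewrite eq_sym (negPf kh).
Qed.

Lemma blocking_edge_coalition mu e : responsive G -> matching G mu ->
  e \in E :\: mu -> edge_weakly_blocks G mu e ->
  exists2 C, C != set0 & coalition_weakly_blocks G C mu.
Proof.
move=> hG mmu eD /and3P[wd wh s].
have [J [iJ eJ sJ JI stJ]] := blocks_hospital_improves hG mmu eD wh.
have mJ := star_matching iJ; have sJE := indep_ground iJ.
have J2 x : x \in J -> x.2 = e.2.
  by move/(subsetP sJE); rewrite inE /= => /andP[_ /eqP].
have eqJ := edges_at_star sJE.
exists (inr e.2 |: [set inl x.1 | x in J]).
  by apply/set0Pn; exists (inr e.2); apply: setU11.
(* The deviation is [J] itself: apart from [e], its edges already belong to [mu], so their doctors
   are indifferent. *)
have prefJ x : x \in J -> dpref G x.1 (assigned J x.1) (assigned mu x.1).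
  move=> xJ; rewrite (assigned_mem mJ xJ).
  have := subsetP sJ x xJ; rewrite in_setU1 => /orP[/eqP -> //|].
  rewrite inE => /andP[xmu _]; rewrite (assigned_mem mmu xmu).
  have xo := edge_option (subsetP (matching_sub mmu) _ xmu).
  by have := dpref_total xo xo; rewrite orbb.
apply/existsP; exists J; apply/and3P; split.
- rewrite inE mJ; apply/forallP=> v; apply/implyP=> vC.
  apply/subsetP=> x; rewrite inE => /andP[xJ _].
  rewrite inE (subsetP (matching_sub mJ)) //= J2 // setU11 andbT.
  by rewrite in_setU1 /= imset_f.
- apply/forallP=> v; apply/implyP; rewrite in_setU1.
  case/orP=> [/eqP ->|/imsetP[x xJ ->]] /=; last exact: prefJ.
  by rewrite eqJ.
case/orP: s => [/andP[_ sd]|/stJ nIJ]; apply/existsP.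
  exists (inl e.1); rewrite in_setU1 imset_f ?orbT //=.
  by rewrite /strict /= prefJ // (assigned_mem mJ eJ).
exists (inr e.2); rewrite setU11 /=.
by rewrite /strict /= eqJ JI nIJ.
Qed.

Lemma stable_no_coalition mu C : responsive G -> matching G mu ->
  (forall e, e \in E :\: mu -> ~~ edge_weakly_blocks G mu e) ->
  ~~ coalition_weakly_blocks G C mu.
Proof.
move=> hG mmu st; apply/negP => /existsP[sigma /and3P[]].
rewrite inE => /andP[ms /forallP sC] /forallP wp /existsP[v /andP[vC sv]].
have within u x : u \in C -> x \in edges_at sigma u ->
    (inl x.1 \in C) && (inr x.2 \in C).
  by move=> uC /(subsetP (implyP (sC u) uC)); rewrite inE => /andP[].
(* Coalition doctors weakly prefer [sigma], so stability of [mu] yields domination at each coalition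
   hospital. *)
have weak x : x \in sigma -> inl x.1 \in C -> weakly_blocks_doctor G mu x.
  by move=> xs xC; have := implyP (wp _) xC; rewrite /= (assigned_mem ms xs).
have dom h : inr h \in C ->
    dominated h (edges_at mu (inr h)) (edges_at sigma (inr h)).
  move=> hC e /setDP[es]; have /andP[e1C _] := within _ _ hC es.
  move: es; rewrite !inE => /andP[es /eqP eh]; subst h.
  rewrite /= eqxx andbT => emu.
  have eE := subsetP (matching_sub ms) _ es.
  have eD : e \in E :\: mu by rewrite in_setD emu.
  by have [] := stable_dominated mmu eE emu (st e eD) (weak e es e1C).
case: v vC sv => [d|h] vC /andP[/= pv npv]; last first.
  by case/negP: npv; apply: hpref_dominated (dom h vC); rewrite // matching_indep.
(* A strictly gaining doctor cannot be unmatched in [sigma], as [None] is a worst option. *)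
case A: (assigned sigma d) => [e|]; last first.
  rewrite A in npv; case B: (assigned mu d) npv => [f|].
    have [fmu <-] := assigned_Some B.
    have fE := subsetP (matching_sub mmu) f fmu.
    have /andP[-> //] : strict (dpref G f.1) (Some f) None.
    by apply: dpref_None; rewrite inE fE /=.
  have No : None \in doctor_options E d by apply: setU11.
  by have := dpref_total No No; rewrite orbb => ->.
have [es ed] := assigned_Some A; subst d.
have eE := subsetP (matching_sub ms) _ es.
have /andP[_ hC] : (inl e.1 \in C) && (inr e.2 \in C).
  by apply: (within _ _ vC); rewrite inE es /=.
have emu : e \notin mu.
  apply: contra npv => emu; rewrite A (assigned_mem mmu emu).
  by have := dpref_total (edge_option eE) (edge_option eE); rewrite orbb.
have eD : e \in E :\: mu by rewrite in_setD emu.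
have [_ _ sd] := stable_dominated mmu eE emu (st e eD) (weak e es vC).
(* The hospital of [e] is in the coalition too, and the doctor's strict gain makes it strictly
   lose. *)
have := implyP (wp _) hC; apply/negP; rewrite /=.
apply: (strict_hpref_dominated hG (e := e)); rewrite ?matching_indep //.
- exact: dom.
- by rewrite !inE (negPf emu) es /= eqxx.
by apply: sd; rewrite /strongly_blocks_doctor /blocks_doctor /strict -A pv npv.
Qed.

End Markets.

Theorem theorem2 (D H : finType) (G : market D H) (hG : responsive G) :
  strongly_stable_matchings G = strong_core G.
Proof.
apply/setP=> mu; rewrite !inE; case mmu: (matching G mu) => //=.
apply/forallP/forallP=> [st C|core e]; apply/implyP.
  by move=> _; apply: stable_no_coalition => // e eD; apply: implyP (st e) eD.
move=> eD; apply/negP=> /(blocking_edge_coalition hG mmu eD)[C C0].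
by apply/negP; apply: implyP (core C) C0.
Qed.
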